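(* Let $\Lambda$ be a row-finite $k$-graph without sources and $v\in\Lambda^0$. Then $v$ is a line point of $\Lambda$ if and only if $v=v(0)$ is an aperiodic atom in the talented monoid $T_\Lambda$.
   Context: **$k$-graphs.** $\mathbb{N}=\{0,1,2,\dots\}$, $k\ge 1$, $e_i$ is the $i$-th standard generator of $\mathbb{N}^k$; $\mathbb{N}^k$ is ordered coordinatewise. A $k$-graph is a countable small category $\Lambda$ with object set $\Lambda^0$ (identified with the identity morphisms), range and source maps $r,s:\Lambda\to\Lambda^0$, and a functor $d:\Lambda\to\mathbb{N}^k$ with the unique factorization property: if $d(\lambda)=m+n$ there are unique $\mu_1,\mu_2\in\Lambda$ with $\lambda=\mu_1\mu_2$, $d(\mu_1)=m$, $d(\mu_2)=n$ (the product $\mu_1\mu_2$ is defined iff $s(\mu_1)=r(\mu_2)$). $v\Lambda^n=\{\lambda: r(\lambda)=v, d(\lambda)=n\}$. $\Lambda$ is row-finite if every $v\Lambda^n$ is finite, and has no sources if every $v\Lambda^n$ is nonempty. **Line points.** Let $\Omega_k=\{(m,n)\in\mathbb{N}^k\times\mathbb{N}^k: m\le n\}$ be the $k$-graph with $r(m,n)=m$, $s(m,n)=n$, $(m,n)(n,p)=(m,p)$, $d(m,n)=n-m$. $\Lambda^\infty$ is the set of degree-preserving functors $x:\Omega_k\to\Lambda$; $x(m):=x(m,m)$, $v\Lambda^\infty=\{x\in\Lambda^\infty: x(0)=v\}$, and $\sigma^p(x)(m,n)=x(m+p,n+p)$. An infinite path $x$ is aperiodic if $\sigma^m(x)=\sigma^n(x)$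 for $m,n\in\mathbb{N}^k$ implies $m=n$. A vertex $v$ is a line point if $v\Lambda^\infty=\{x\}$ for a single infinite path $x$ and $x$ is aperiodic. **Talented monoid.** $T_\Lambda$ is the commutative monoid generated by symbols $v(n)$ ($v\in\Lambda^0$, $n\in\mathbb{Z}^k$) subject to $v(n)=\sum_{\alpha\in v\Lambda^{e_i}}s(\alpha)(n+e_i)$ for all $v$, $n$ and $i\in\{1,\dots,k\}$ with $v\Lambda^{e_i}\neq\emptyset$. $\mathbb{Z}^k$ acts on it by monoid automorphisms determined by ${}^{n}v(m)=v(m+n)$. With $x\le y$ iff $y=x+z$ for some $z$, a unit is an element $u\le 0$, and a nonunit $a$ is an atom if $a=b+c$ implies $b$ or $c$ is a unit. A nonzero $a$ is periodic if ${}^{n}a=a$ for some $0\ne n\in\mathbb{Z}^k$, otherwise aperiodic. *)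

(* Defs.v *)
From HB Require Import structures.
From mathcomp Require Import all_boot all_order all_algebra finmap multiset.
From mathcomp Require Import boolp classical_sets functions cardinality fsbigop.
Set Implicit Arguments.
Unset Strict Implicit.
Unset Printing Implicit Defensive.
Import GRing.Theory.
Local Open Scope mset_scope.
Local Open Scope classical_set_scope.
Local Open Scope quotient_scope.
Local Open Scope ring_scope.

Notation natvec k := {ffun 'I_k -> nat}.
Notation intvec k := {ffun 'I_k -> int}.

Section Natvec.
Variable k : nat.
Implicit Types m n p : natvec k.

Definition evec (i : 'I_k) : natvec k := [ffun j => (j == i : nat)].

Definition int_of_natvec n : intvec k := [ffun i => (n i)%:Z].

Definition levec m n : bool := [forall i, (m i <= n i)%N].

(* n - m, used only when m <= n. *)
Definition subvec n m : natvec k := [ffun i => (n i - m i)%N].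

Lemma levecP m n : reflect (forall i, (m i <= n i)%N) (levec m n).
Proof. exact: forallP. Qed.

Lemma addvecE m n i : (m + n) i = (m i + n i)%N.
Proof. by rewrite ffunE. Qed.

Lemma levec_refl n : levec n n.
Proof. exact/levecP. Qed.

Lemma levec_trans n m p : levec m n -> levec n p -> levec m p.
Proof.
by move=> /levecP mn /levecP np; apply/levecP => i; apply: leq_trans (np i).
Qed.

Lemma levecD2r p m n : levec m n -> levec (m + p) (n + p).
Proof. by move=> /levecP mn; apply/levecP => i; rewrite !addvecE leq_add2r. Qed.

Lemma levec_addr m n : levec m (m + n).
Proof. by apply/levecP => i; rewrite addvecE leq_addr. Qed.

End Natvec.

(* The composite [comp l m] of the k-graph is only defined when
   [src l = rng m]; its value on other pairs is irrelevant, and no axiom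
   constrains it. *)
Record kgraph (k : nat) := KGraph {
  vert : countType;
  mor : countType;
  rng : mor -> vert;
  src : mor -> vert;
  idm : vert -> mor;
  comp : mor -> mor -> mor;
  deg : mor -> natvec k;
  rng_id : forall v, rng (idm v) = v;
  src_id : forall v, src (idm v) = v;
  rng_comp : forall a b, src a = rng b -> rng (comp a b) = rng a;
  src_comp : forall a b, src a = rng b -> src (comp a b) = src b;
  comp_idl : forall a, comp (idm (rng a)) a = a;
  comp_idr : forall a, comp a (idm (src a)) = a;
  compA : forall a b c, src a = rng b -> src b = rng c ->
    comp a (comp b c) = comp (comp a b) c;
  deg_id : forall v, deg (idm v) = 0;
  deg_comp : forall a b, src a = rng b -> deg (comp a b) = deg a + deg b;
  factorization : forall a m n, deg a = m + n ->
    exists! p : mor * mor, [/\ src p.1 = rng p.2, a = comp p.1 p.2,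
                               deg p.1 = m & deg p.2 = n]
}.
Arguments idm {k} _ _.

Section KGraph.
Variables (k : nat) (L : kgraph k).

Definition paths_from (v : vert L) (n : natvec k) : set (mor L) :=
  [set a | rng a = v /\ deg a = n].

Definition row_finite := forall v n, finite_set (paths_from v n).

Definition no_sources := forall v n, paths_from v n !=set0.

End KGraph.

Record kmorph (k : nat) (G L : kgraph k) := KMorph {
  fobj : vert G -> vert L;
  fmor :> mor G -> mor L;
  fmor_rng : forall a, rng (fmor a) = fobj (rng a);
  fmor_src : forall a, src (fmor a) = fobj (src a);
  fmor_id : forall v, fmor (idm G v) = idm L (fobj v);
  fmor_comp : forall a b, src a = rng b ->
    fmor (comp a b) = comp (fmor a) (fmor b);
  fmor_deg : forall a, deg (fmor a) = deg a
}.

Lemma kmorph_ext k (G L : kgraph k) (f g : kmorph G L) : fmor f =1 fmor g -> f = g.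
Proof.
case: f => fo fm fr fs fi fc fd; case: g => go gm gr gs gi gc gd /= fg.
have e : fm = gm by apply/funext.
have eo : fo = go.
  by apply/funext => v; rewrite -[LHS]rng_id -[RHS]rng_id -fi -gi fg.
clear fg; subst gm go; congr KMorph; exact: Prop_irrelevance.
Qed.

Section KMorphComp.
Variables (k : nat) (G H L : kgraph k) (f : kmorph H L) (g : kmorph G H).

Program Definition kmorph_comp : kmorph G L :=
  @KMorph k G L (fobj f \o fobj g) (fmor f \o fmor g) _ _ _ _ _.
Next Obligation. by rewrite !fmor_rng. Qed.
Next Obligation. by rewrite !fmor_src. Qed.
Next Obligation. by rewrite !fmor_id. Qed.
Next Obligation.
by rewrite fmor_comp// fmor_comp// fmor_src fmor_rng H0.
Qed.
Next Obligation. by rewrite !fmor_deg. Qed.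

End KMorphComp.

Section Omega.
Variable k : nat.

Definition omega_mor := {p : natvec k * natvec k | levec p.1 p.2}.
HB.instance Definition _ := Countable.on omega_mor.

Definition omega_rng (a : omega_mor) : natvec k := (val a).1.
Definition omega_src (a : omega_mor) : natvec k := (val a).2.
Definition omega_id (m : natvec k) : omega_mor := Sub (m, m) (levec_refl m).
Definition omega_comp (a b : omega_mor) : omega_mor :=
  insubd a (omega_rng a, omega_src b).
Definition omega_deg (a : omega_mor) : natvec k :=
  subvec (omega_src a) (omega_rng a).

Lemma omega_compE (a b : omega_mor) : omega_src a = omega_rng b ->
  val (omega_comp a b) = (omega_rng a, omega_src b).
Proof.
rewrite /omega_rng /omega_src => ab; rewrite val_insubd /= ifT//.
by apply: (levec_trans (valP a)); rewrite ab; apply: (valP b).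
Qed.

Lemma omega_factorization (a : omega_mor) (m n : natvec k) :
  omega_deg a = m + n ->
  exists! p : omega_mor * omega_mor,
    [/\ omega_src p.1 = omega_rng p.2, a = omega_comp p.1 p.2,
        omega_deg p.1 = m & omega_deg p.2 = n].
Proof.
case: a => [[x y] /= xy]; rewrite /omega_deg /omega_src /omega_rng /= => yx.
have yE : y = x + m + n.
  apply/ffunP => i; move/ffunP/(_ i): yx; move/levecP/(_ i): xy.
  by rewrite !addvecE ffunE/= -addnA => + <- => ?; rewrite subnKC.
subst y; pose z := x + m.
pose p1 : omega_mor := Sub (x, z) (levec_addr x m).
pose p2 : omega_mor := Sub (z, z + n) (levec_addr z n).
exists (p1, p2); split => /=.
  split=> //.
  - by apply: val_inj; rewrite omega_compE.
  - by apply/ffunP => i; rewrite !ffunE/= addKn.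
  - by apply/ffunP => i; rewrite ffunE/= [X in (X - _)%N]addvecE addKn.
move=> [[[q1 q2] /= hq] [[q3 q4] /= hq']] /= [eq /(congr1 val)].
rewrite omega_compE//= /omega_rng /omega_src/= => -[? ?]; subst q1 q3 q4 => mE nE.
have q2E : z = q2.
  apply/ffunP => i; move/ffunP/(_ i): mE; move/levecP/(_ i): hq.
  by rewrite addvecE ffunE/= => + <- => ?; rewrite subnKC.
by subst q2; congr pair; apply: val_inj.
Qed.

Program Definition Omega : kgraph k :=
  @KGraph k (natvec k) omega_mor omega_rng omega_src omega_id omega_comp
    omega_deg _ _ _ _ _ _ _ _ _ omega_factorization.
Next Obligation. by rewrite /omega_rng omega_compE. Qed.
Next Obligation. by rewrite /omega_src omega_compE. Qed.
Next Obligation. by apply: val_inj; rewrite omega_compE//; case: a => -[]. Qed.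
Next Obligation. by apply: val_inj; rewrite omega_compE//; case: a => -[]. Qed.
Next Obligation.
apply: val_inj; rewrite !omega_compE//.
- by rewrite /omega_rng /omega_src !omega_compE.
- by rewrite /omega_src omega_compE.
- by rewrite /omega_rng omega_compE.
Qed.
Next Obligation. by apply/ffunP => i; rewrite !ffunE/= subnn. Qed.
Next Obligation.
rewrite /omega_deg /omega_rng /omega_src omega_compE//=.
apply/ffunP => i; rewrite addvecE !ffunE.
move: H; rewrite /omega_rng /omega_src => ab.
have /levecP/(_ i) ha := valP a; have /levecP/(_ i) hb := valP b.
by rewrite addnC -ab addnBA // subnK // ab.
Qed.

Definition omega_translate_mor (p : natvec k) (a : omega_mor) : omega_mor :=
  Sub (omega_rng a + p, omega_src a + p) (levecD2r p (valP a)).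

Program Definition omega_translate (p : natvec k) : kmorph Omega Omega :=
  @KMorph k Omega Omega (fun m => m + p) (omega_translate_mor p) _ _ _ _ _.
Next Obligation. exact: val_inj. Qed.
Next Obligation.
apply: val_inj; rewrite omega_compE /=; last by rewrite /omega_src /omega_rng/= H.
by rewrite /omega_rng /omega_src/= omega_compE.
Qed.
Next Obligation. by apply/ffunP => i; rewrite !ffunE/= subnDr. Qed.

End Omega.

Section InfinitePaths.
Variables (k : nat) (L : kgraph k).

Definition infpath := kmorph (Omega k) L.

(* x(m); by [fmor_id] it is the identity morphism x(m, m) seen as an object. *)
Definition path_vertex (x : infpath) (m : natvec k) : vert L := fobj x m.

Definition infpaths_from (v : vert L) : set infpath :=
  [set x | path_vertex x 0 = v].

Definition shift (p : natvec k) (x : infpath) : infpath :=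
  kmorph_comp x (omega_translate p).

Definition aperiodic_path (x : infpath) :=
  forall m n : natvec k, shift m x = shift n x -> m = n.

Definition line_point (v : vert L) :=
  exists x : infpath, infpaths_from v = [set x] /\ aperiodic_path x.

End InfinitePaths.

(* {mset K} is the free commutative monoid on K. *)
Section FreeCommutativeMonoid.
Variable K : choiceType.

HB.instance Definition _ := Choice.on {mset K}.
HB.instance Definition _ := GRing.isNmodule.Build {mset K}
  (@msetDA K) (@msetDC K) (@mset0D K).

End FreeCommutativeMonoid.

Definition mset_map (K K' : choiceType) (f : K -> K') (a : {mset K}) : {mset K'} :=
  \sum_(x <- a) [mset f x].

Section MsetMap.
Variables K K' : choiceType.
Implicit Types (f : K -> K') (a b : {mset K}).

Lemma big_msetD (M : nmodType) (F : K -> M) a b :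
  \sum_(x <- (a + b : {mset K})) F x = \sum_(x <- a) F x + \sum_(x <- b) F x.
Proof.
rewrite -big_cat; apply: perm_big; apply/allP => x _ /=.
by rewrite count_cat !count_mem_mset msetE2.
Qed.

Lemma mset_map0 f : mset_map f 0 = 0.
Proof. by rewrite /mset_map big_mset0. Qed.

Lemma mset_mapD f a b : mset_map f (a + b) = mset_map f a + mset_map f b.
Proof. exact: big_msetD. Qed.

Lemma mset_map1 f x : mset_map f [mset x] = [mset f x].
Proof. by rewrite /mset_map enum_msetn /= big_seq1. Qed.

Lemma mset_sum1 a : a = \sum_(x <- a) [mset x].
Proof.
apply/msetP => y; rewrite -[LHS]count_mem_mset.
elim: (a : seq K) => [|x s IHs]; first by rewrite big_nil mset0E.
by rewrite big_cons msetE2 -IHs msetnE /= eq_sym; case: (y == x).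
Qed.

End MsetMap.

(* The commutative monoid presented by generators K and relations r. *)
Section Presentation.
Variables (K : choiceType) (r : {mset K} -> {mset K} -> Prop).

Inductive mcong : {mset K} -> {mset K} -> Prop :=
| mcong_rel a b : r a b -> mcong a b
| mcong_refl a : mcong a a
| mcong_sym a b : mcong a b -> mcong b a
| mcong_trans a b c : mcong a b -> mcong b c -> mcong a c
| mcong_add a b c d : mcong a b -> mcong c d -> mcong (a + c) (b + d).

Definition mcongb (a b : {mset K}) : bool := `[< mcong a b >].

Lemma mcongb_refl : reflexive mcongb.
Proof. by move=> a; apply/asboolP/mcong_refl. Qed.

Lemma mcongb_sym : symmetric mcongb.
Proof. by move=> a b; apply: asbool_equiv_eq; split; apply: mcong_sym. Qed.

Lemma mcongb_trans : transitive mcongb.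
Proof.
by move=> b a c /asboolP ab /asboolP bc; apply/asboolP/(mcong_trans ab bc).
Qed.

Canonical mcong_equiv := EquivRel mcongb mcongb_refl mcongb_sym mcongb_trans.

Definition presented := {eq_quot mcong_equiv}.
HB.instance Definition _ := Choice.on presented.
HB.instance Definition _ := EqQuotient.on presented.

Definition class_of (a : {mset K}) : presented := \pi_presented a.

Lemma class_ofP a b : class_of a = class_of b <-> mcong a b.
Proof.
split=> [/eqmodP/asboolP//|ab].
by apply/eqmodP/asboolP.
Qed.

Lemma repr_class a : mcong (repr (class_of a)) a.
Proof. by apply/class_ofP; rewrite /class_of reprK. Qed.

Lemma class_of_repr (x : presented) : class_of (repr x) = x.
Proof. exact: reprK. Qed.

Definition presented_add (x y : presented) : presented :=
  class_of (repr x + repr y).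

Lemma presented_addE a b :
  presented_add (class_of a) (class_of b) = class_of (a + b).
Proof. by apply/class_ofP/mcong_add; apply: repr_class. Qed.

Lemma presented_addA : associative presented_add.
Proof.
move=> x y z; rewrite -[x]class_of_repr -[y]class_of_repr -[z]class_of_repr.
by rewrite !presented_addE addrA.
Qed.

Lemma presented_addC : commutative presented_add.
Proof. by move=> x y; rewrite /presented_add addrC. Qed.

Lemma presented_add0 : left_id (class_of 0) presented_add.
Proof. by move=> x; rewrite -[x]class_of_repr presented_addE add0r. Qed.

HB.instance Definition _ := GRing.isNmodule.Build presented
  presented_addA presented_addC presented_add0.

Lemma class_ofD a b : class_of (a + b) = class_of a + class_of b.
Proof. by rewrite [RHS]presented_addE. Qed.

Lemma class_of0 : class_of 0 = 0.
Proof. by []. Qed.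

Definition gen (x : K) : presented := class_of [mset x].

End Presentation.

Section MonoidOrder.
Variable M : nmodType.
Implicit Types a b c x y u : M.

Definition mon_le x y := exists z, y = x + z.

Definition mon_unit u := mon_le u 0.

Definition atom a :=
  ~ mon_unit a /\ forall b c, a = b + c -> mon_unit b \/ mon_unit c.

End MonoidOrder.

Section Talented.
Variables (k : nat) (L : kgraph k).

Definition tgen : choiceType := (vert L * intvec k)%type.

(* The sum is over a finite set when L is row-finite, which is the only case
   in which the talented monoid is considered ([\sum_(a \in A)] is 0 if A is
   infinite). *)
Inductive talented_rel : {mset tgen} -> {mset tgen} -> Prop :=
| TalentedRel (v : vert L) (n : intvec k) (i : 'I_k) :
    paths_from v (evec i) !=set0 ->
    talented_rel [mset (v, n)]
      (\sum_(a \in paths_from v (evec i))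
         ([mset (src a, n + int_of_natvec (evec i))] : {mset tgen})).

Definition talented := presented talented_rel.
HB.instance Definition _ := GRing.Nmodule.on talented.

Definition tvert (v : vert L) (n : intvec k) : talented := gen _ (v, n).

Definition tgen_shift (n : intvec k) (g : tgen) : tgen := (g.1, g.2 + n).

Definition tact (n : intvec k) (x : talented) : talented :=
  class_of _ (mset_map (tgen_shift n) (repr x)).

Lemma mset_map_fsbig (f : tgen -> tgen) (A : set (mor L)) (F : mor L -> tgen) :
  mset_map f (\sum_(a \in A) ([mset F a] : {mset tgen})) =
  \sum_(a \in A) ([mset f (F a)] : {mset tgen}).
Proof.
have [fA|nA] := pselect (finite_set A).
  rewrite !fsbig_finite// (big_morph _ (mset_mapD f) (mset_map0 f)).
  by apply: eq_bigr => a _; rewrite mset_map1.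
have sA (G : mor L -> tgen) :
    A `&` (fun a => [mset G a] : {mset tgen}) @^-1` [set~ 0] = A.
  apply/seteqP; split => [a []//|a Aa]; split => //= /msetP/(_ (G a)).
  by rewrite msetnE eqxx mset0E.
by rewrite !fsbig_dflt ?sA// mset_map0.
Qed.

Lemma mcong_shift n a b : mcong talented_rel a b ->
  mcong talented_rel (mset_map (tgen_shift n) a) (mset_map (tgen_shift n) b).
Proof.
elim=> {a b} [_ _ [v m i vi]|a|a b _|a b c _ ab _|a b c d _ ab _ cd].
- rewrite mset_map1 mset_map_fsbig /tgen_shift /= addrAC.
  exact: (mcong_rel (TalentedRel (m + n) vi)).
- exact: mcong_refl.
- exact: mcong_sym.
- exact: mcong_trans.
- by rewrite !mset_mapD; apply: mcong_add.
Qed.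

Lemma tact_class n a :
  tact n (class_of _ a) = class_of _ (mset_map (tgen_shift n) a).
Proof. exact/class_ofP/mcong_shift/repr_class. Qed.

Lemma tact_vert n v m : tact n (tvert v m) = tvert v (m + n).
Proof. by rewrite /tvert /gen tact_class mset_map1. Qed.

Lemma tact_is0 n : tact n 0 = 0.
Proof. by rewrite -class_of0 tact_class mset_map0. Qed.

Lemma tactD n x y : tact n (x + y) = tact n x + tact n y.
Proof.
rewrite -[x]class_of_repr -[y]class_of_repr -class_ofD !tact_class.
by rewrite mset_mapD class_ofD.
Qed.

Lemma talented_ind (P : talented -> Prop) :
  P 0 -> (forall v n x, P x -> P (tvert v n + x)) -> forall x, P x.
Proof.
move=> P0 PD x; rewrite -[x]class_of_repr [repr x]mset_sum1.
elim: (repr x : seq tgen) => [|[v n] s IHs]; first by rewrite big_nil class_of0.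
by rewrite big_cons class_ofD; apply: PD.
Qed.

Lemma tact0 x : tact 0 x = x.
Proof.
elim/talented_ind: x => [|v n x IHx]; first exact: tact_is0.
by rewrite tactD IHx tact_vert addr0.
Qed.

Lemma tact_add m n x : tact (m + n) x = tact m (tact n x).
Proof.
elim/talented_ind: x => [|v p x IHx]; first by rewrite !tact_is0.
by rewrite !tactD IHx !tact_vert addrA addrAC.
Qed.

Lemma tvert_rel v n i : finite_set (paths_from v (evec i)) ->
  paths_from v (evec i) !=set0 ->
  tvert v n = \sum_(a \in paths_from v (evec i))
                tvert (src a) (n + int_of_natvec (evec i)).
Proof.
move=> fv vi; have /class_ofP E := mcong_rel (TalentedRel n vi).
rewrite /tvert /gen [LHS]E.
by rewrite !fsbig_finite// (big_morph _ (@class_ofD _ _) (class_of0 _)).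
Qed.

Definition periodic (a : talented) :=
  a <> 0 /\ exists n : intvec k, n <> 0 /\ tact n a = a.

Definition aperiodic (a : talented) := a <> 0 /\ ~ periodic a.

End Talented.

(* Main.v *)
Require Import Defs.
From mathcomp Require Import all_boot all_order all_algebra.
From mathcomp Require Import finmap multiset.
From mathcomp Require Import boolp classical_sets cardinality fsbigop.
From mathcomp Require Import zify.
Set Implicit Arguments.
Unset Strict Implicit.
Unset Printing Implicit Defensive.
Import GRing.Theory.
Local Open Scope mset_scope.
Local Open Scope classical_set_scope.
Local Open Scope ring_scope.

(** The proof rests on an intermediate notion: a vertex [v] is thin when
    each set of paths [v Lambda^n] has at most one element.

    Since every finite path extends to an infinite one ([path_extends]), a
    line point is thin; conversely, since an infinite path is determined by
    its initial segments, a thin vertex emits exactly one infinite path.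

    If [v(0)] is an atom, then splitting the sum
    [v(0) = sum_(alpha in v Lambda^(e_i)) s(alpha)(e_i)] shows that it has a
    single term, which is again an atom.  By induction along paths [v] is thin,
    and [v(0) = w(p)] for each path of degree [p] from [v] to [w]
    ([atom_path]).  If the infinite path [x] at [v] satisfies
    [sigma^m x = sigma^n x] with [m <> n], then [v(0) = x(m)(m) = x(m)(n)], and
    [v(0)] is fixed by [m - n].

    For the other implication one needs to know that certain elements of the
    talented monoid differ.  Fix [v].  Give a generator [w(n)] weight 1 if [w]
    is thin and its unique path eventually merges with the one of [v], at the
    degree prescribed by [n], and weight 2 otherwise.  Adding the weights and
    truncating at 2 is compatible with the defining relations
    ([weight_mcong]).  Nonempty sums have positive weight, so if [v] is thin,
    [v(0)], being of weight 1, is an atom; and if [v(n) = v(0)] then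
    [v(n)] has weight 1, so the path [x] of [v] passes through the same vertex
    at two degrees [p] and [q] with [p - q = n].  That vertex is thin, so
    [sigma^p x = sigma^q x], and [n = 0] if [x] is aperiodic. *)

(** * Degrees *)

Section Degrees.
Variable k : nat.
Implicit Types m n p q : natvec k.

Lemma addvecI m : injective (+%R m).
Proof.
move=> p q /ffunP pq; apply/ffunP => i.
by have := pq i; rewrite !addvecE => /addnI.
Qed.

Lemma subvecK {m n} : levec m n -> n = m + subvec n m.
Proof.
by move=> /levecP mn; apply/ffunP => i; rewrite addvecE ffunE subnKC.
Qed.

Lemma levec0 n : levec 0 n.
Proof. by apply/levecP => i; rewrite ffunE. Qed.

Lemma int_of_natvecD m n :
  int_of_natvec (m + n) = int_of_natvec m + int_of_natvec n.
Proof. by apply/ffunP => i; rewrite !ffunE. Qed.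

Lemma int_of_natvec_inj : injective (@int_of_natvec k).
Proof.
by move=> m n /ffunP mn; apply/ffunP => i; have := mn i; rewrite !ffunE => -[].
Qed.

(** Induction that adds one standard generator at a time. *)
Lemma natvec_ind (P : natvec k -> Prop) :
  P 0 -> (forall i n, P n -> P (evec i + n)) -> forall n, P n.
Proof.
move=> P0 PS n; have [N] := ubnP (\sum_i n i)%N.
elim: N n => // N IHN n nN.
have [/existsP[i ni]|/existsPn n0] := boolP [exists i, n i != 0%N].
  have ein : levec (evec i) n.
    by apply/levecP => j; rewrite ffunE; case: eqP => // ->; rewrite lt0n.
  rewrite (subvecK ein); apply/PS/IHN.
rewrite -ltnS; apply: leq_trans nN; rewrite ltnS.
  rewrite (bigD1 i)//= [X in (_ < X)%N](bigD1 i)//=.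
  rewrite !ffunE eqxx -addSn leq_add//; first by rewrite subn1 prednK// lt0n.
  by apply: leq_sum => j _; rewrite !ffunE leq_subr.
suff -> : n = 0 by [].
by apply/ffunP => i; rewrite ffunE; apply/eqP; rewrite -[_ == _]negbK.
Qed.

End Degrees.

(** * Factorizations and prefixes in a k-graph *)

Section Paths.
Variables (k : nat) (L : kgraph k).
Implicit Types (a b c : mor L) (m n p q : natvec k) (v w : vert L).

Lemma factor a m n : deg a = m + n ->
  exists b c, [/\ src b = rng c, a = Defs.comp b c, deg b = m & deg c = n].
Proof. by move=> /factorization [[b c] [/= H _]]; exists b, c. Qed.

(** The two factorizations are compared through unique factorization, so only
    the degrees of the first factors need to be known equal: degrees cancel. *)
Lemma comp_inj a b c d : src a = rng b -> src c = rng d -> deg a = deg c ->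
  Defs.comp a b = Defs.comp c d -> a = c /\ b = d.
Proof.
move=> ab cd ac E.
have bd : deg b = deg d.
  by apply: (@addvecI _ (deg a)); rewrite -(deg_comp ab) E deg_comp// ac.
have [p [_ U]] := factorization (deg_comp ab).
have Eab := U (a, b) (And4 ab erefl erefl erefl).
have := U (c, d) (And4 cd E (esym ac) (esym bd)).
by rewrite Eab => -[-> ->].
Qed.

Lemma deg0_id a : deg a = 0 -> a = idm L (rng a).
Proof.
move=> a0.
have := @comp_inj (idm L (rng a)) a a (idm L (src a)).
rewrite src_id rng_id comp_idl comp_idr deg_id a0.
by move=> /(_ erefl erefl erefl erefl) [].
Qed.

Lemma deg0_src a : deg a = 0 -> src a = rng a.
Proof. by move=> /deg0_id ->; rewrite src_id rng_id. Qed.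

(** [a] is an initial segment of [b]. *)
Definition path_prefix a b := exists2 c, src a = rng c & b = Defs.comp a c.

Lemma prefix_refl a : path_prefix a a.
Proof. by exists (idm L (src a)); rewrite ?rng_id ?comp_idr. Qed.

Lemma prefix_trans b a c :
  path_prefix a b -> path_prefix b c -> path_prefix a c.
Proof.
move=> [d ad ->] [e + ->]; rewrite src_comp// => de.
by exists (Defs.comp d e); rewrite ?rng_comp ?Defs.compA.
Qed.

Lemma prefix_exists m a : levec m (deg a) ->
  exists2 b, path_prefix b a & deg b = m.
Proof.
by move=> /subvecK /factor [b [c [bc -> <- _]]]; exists b => //; exists c.
Qed.

Lemma prefix_uniq a b c : path_prefix a c -> path_prefix b c ->
  deg a = deg b -> a = b.
Proof.
by move=> [d ad ->] [e be E] ab; have [] := comp_inj ad be ab E.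
Qed.

Lemma prefix_total a b c : path_prefix a c -> path_prefix b c ->
  levec (deg a) (deg b) -> path_prefix a b.
Proof.
move=> ac bc /prefix_exists[a' a'b a'a].
by have -> := prefix_uniq ac (prefix_trans a'b bc) (esym a'a).
Qed.

End Paths.

(** * Infinite paths *)

Section InfinitePathTheory.
Variables (k : nat) (L : kgraph k).
Implicit Types (a b c : mor L) (m n p q : natvec k) (v w : vert L).
Implicit Types (x y z : infpath L).

(** The morphism [(0, q)] of [Omega k]. *)
Definition omega_init q : omega_mor k := Sub (0, q) (levec0 q).

Lemma omega_comp_init (a : omega_mor k) :
  omega_comp (omega_init (omega_rng a)) a = omega_init (omega_src a).
Proof. by apply: val_inj; rewrite omega_compE. Qed.

Lemma init_deg x q : deg (x (omega_init q)) = q.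
Proof.
rewrite fmor_deg; apply/ffunP => i.
by rewrite ffunE /omega_src /omega_rng/= !ffunE subn0.
Qed.

Lemma init_rng x q : rng (x (omega_init q)) = path_vertex x 0.
Proof. by rewrite fmor_rng. Qed.

Lemma init_src x q : src (x (omega_init q)) = path_vertex x q.
Proof. by rewrite fmor_src. Qed.

Lemma init_paths_from x q :
  paths_from (path_vertex x 0) q (x (omega_init q)).
Proof. by split; rewrite ?init_rng ?init_deg. Qed.

Lemma init_factor x (a : omega_mor k) :
  src (x (omega_init (omega_rng a))) = rng (x a) /\
  x (omega_init (omega_src a)) =
    Defs.comp (x (omega_init (omega_rng a))) (x a).
Proof.
split; first by rewrite init_src fmor_rng.
by rewrite -(fmor_comp x (a := omega_init _) (b := a))//= omega_comp_init.
Qed.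

Lemma infpath_ext x y :
  (forall q, x (omega_init q) = y (omega_init q)) -> x = y.
Proof.
move=> xy; apply: kmorph_ext => a.
have [sx Ex] := init_factor x a; have [sy Ey] := init_factor y a.
have [] // := comp_inj sx sy; first by rewrite xy.
by rewrite -Ex -Ey xy.
Qed.

Lemma shift_vertex0 x p : path_vertex (shift p x) 0 = path_vertex x p.
Proof. by rewrite /path_vertex /= add0r. Qed.

(** A coherent family of paths, one of each degree, is the family of initial
    segments of an infinite path. *)
Lemma infpath_of_prefixes (P : natvec k -> mor L) :
  (forall q, deg (P q) = q) ->
  (forall p q, levec p q -> path_prefix (P p) (P q)) ->
  exists x : infpath L, forall q, x (omega_init q) = P q.
Proof.
move=> degP preP.
have /choice[t tP] (a : omega_mor k) : exists t : mor L,
    src (P (omega_rng a)) = rng t /\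
    P (omega_src a) = Defs.comp (P (omega_rng a)) t.
  by have [t] := preP _ _ (valP a); exists t.
(* By cancellation, [t a] is the only path with the defining property. *)
have tu (a : omega_mor k) (c : mor L) : src (P (omega_rng a)) = rng c ->
    P (omega_src a) = Defs.comp (P (omega_rng a)) c -> t a = c.
  move=> sc Pc; have [st Pt] := tP a.
  by have [] // := comp_inj st sc erefl; rewrite -Pt.
have t_rng (a : omega_mor k) : rng (t a) = src (P (omega_rng a)).
  by have [] := tP a.
have t_src (a : omega_mor k) : src (t a) = src (P (omega_src a)).
  by have [st ->] := tP a; rewrite src_comp.
have t_id (m : natvec k) : t (omega_id m) = idm L (src (P m)).
  by apply: tu; rewrite ?rng_id ?comp_idr.
have t_comp (a b : omega_mor k) : omega_src a = omega_rng b ->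
    t (omega_comp a b) = Defs.comp (t a) (t b).
  move=> ab; have tab : src (t a) = rng (t b) by rewrite t_src t_rng ab.
  have E := omega_compE ab.
  have [sa Pa] := tP a; have [sb Pb] := tP b.
  apply: tu; rewrite /omega_rng /omega_src E/=; first by rewrite rng_comp.
  by rewrite Defs.compA// -Pa ab -Pb.
have t_deg (a : omega_mor k) : deg (t a) = omega_deg a.
  have [st /(congr1 (@deg k L))] := tP a.
  rewrite deg_comp// !degP => E.
  by apply: (@addvecI _ (omega_rng a)); rewrite -E; apply: subvecK (valP a).
exists (@KMorph k (Omega k) L (fun q => src (P q)) t t_rng t_src t_id t_comp
  t_deg) => q /=.
have P0 : P 0 = idm L (src (P 0)).
  by rewrite deg0_src//; apply: deg0_id.
have [st Pt] := tP (omega_init q); move: Pt; rewrite /omega_rng/= P0 => ->.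
by move: st; rewrite /omega_rng/= => ->; rewrite comp_idl.
Qed.

Hypothesis hsrc : no_sources L.

(** Every finite path is an initial segment of an infinite one: extend it
    repeatedly by paths of degree [(1, ..., 1)]. *)
Lemma path_extends a : exists x : infpath L, x (omega_init (deg a)) = a.
Proof.
pose one : natvec k := [ffun=> 1%N].
have /choice[e eP] v : exists c : mor L, rng c = v /\ deg c = one.
  by have [c] := hsrc v one; exists c.
have er v : rng (e v) = v by case: (eP v).
have ed v : deg (e v) = one by case: (eP v).
pose l := fix l j :=
  if j is j'.+1 then Defs.comp (l j') (e (src (l j'))) else a.
(* [l j] is [a] extended [j] times; its degree exceeds any given one for
   large [j], and the segment of degree [q] is read off [l (max_i q_i)]. *)
have l_deg j i : deg (l j) i = (deg a i + j)%N.
  elim: j => [|j IHj] /=; first by rewrite addn0.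
  by rewrite deg_comp ?er// addvecE IHj ed ffunE addn1 addnS.
have l_pre i j : (i <= j)%N -> path_prefix (l i) (l j).
  elim: j => [|j IHj]; first by rewrite leqn0 => /eqP->; apply: prefix_refl.
  rewrite leq_eqVlt => /orP[/eqP->|]; first exact: prefix_refl.
  by move=> /IHj /prefix_trans; apply; exists (e (src (l j))).
have q_le q : levec q (deg (l (\max_i q i))).
  apply/levecP => i; rewrite l_deg; apply: leq_trans (leq_addl _ _).
  exact: leq_bigmax.
have /choice[P PP] q : exists b : mor L,
    path_prefix b (l (\max_i q i)) /\ deg b = q.
  by have [b] := prefix_exists (q_le q); exists b.
have P_deg q : deg (P q) = q by case: (PP q).
have P_pre q j : (\max_i q i <= j)%N -> path_prefix (P q) (l j).
  by move=> /l_pre; apply: prefix_trans; case: (PP q).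
have [|x xP] := infpath_of_prefixes P_deg.
  move=> p q pq.
  apply: (prefix_total (P_pre p _ (leq_maxl _ (\max_i q i)))
    (P_pre q _ (leq_maxr (\max_i p i) _))).
  by rewrite !P_deg.
exists x; rewrite xP; apply: (prefix_uniq (P_pre _ _ (leqnn _))) => //.
exact: (l_pre 0%N).
Qed.

(** * Thin vertices *)

(** Each [v Lambda^n] has at most one element; without sources, exactly
    one. *)
Definition thin v := forall n a b,
  paths_from v n a -> paths_from v n b -> a = b.

Lemma thin_init v x n a : thin v -> path_vertex x 0 = v ->
  paths_from v n a -> x (omega_init n) = a.
Proof. by move=> tv xv; apply: tv; rewrite -xv; apply: init_paths_from. Qed.

Lemma thin_infpath_uniq v x y : thin v ->
  path_vertex x 0 = v -> path_vertex y 0 = v -> x = y.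
Proof.
move=> tv xv yv; apply: infpath_ext => q; apply: (thin_init (v := v)) => //.
by rewrite -yv; apply: init_paths_from.
Qed.

Lemma paths_from_comp {v m n a b} : paths_from v m a ->
  paths_from (src a) n b -> paths_from v (m + n) (Defs.comp a b).
Proof.
move=> [<- <-] [ab <-].
by split; [rewrite rng_comp | rewrite deg_comp].
Qed.

Lemma paths_from_factor {v m n a} : paths_from v (m + n) a ->
  exists b c, [/\ paths_from v m b, paths_from (src b) n c &
                  a = Defs.comp b c].
Proof.
move=> [av /factor[b [c [bc E bm cn]]]]; exists b, c; split => //.
by split => //; rewrite -av E rng_comp.
Qed.

Lemma thin_src v m a : thin v -> paths_from v m a -> thin (src a).
Proof.
move=> tv am n b c bn cn.
have E := tv _ _ _ (paths_from_comp am bn) (paths_from_comp am cn).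
by have [] := comp_inj (esym bn.1) (esym cn.1) erefl E.
Qed.

(** Extending two paths of degree [n] from [v] by paths of degree [m] gives two
    paths that both start with [a], hence agree because [src a] is thin. *)
Lemma thin_single v m a : paths_from v m = [set a] -> thin (src a) -> thin v.
Proof.
move=> va ta n b c bn cn.
have [d] := hsrc (src b) m; have [d'] := hsrc (src c) m => d'm dm.
have step e f : paths_from v n e -> paths_from (src e) m f ->
    exists2 g, paths_from (src a) n g & Defs.comp e f = Defs.comp a g.
  move=> en fm; have := paths_from_comp en fm; rewrite addrC.
  move=> /paths_from_factor[a' [g [+ ag ->]]]; rewrite va /= => aa'.
  by subst a'; exists g.
have [g ag E] := step _ _ bn dm; have [g' ag' E'] := step _ _ cn d'm.
rewrite -(ta _ _ _ ag ag') -E in E'.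
have [] // := comp_inj (esym dm.1) (esym d'm.1) _ (esym E').
by rewrite bn.2 cn.2.
Qed.

Lemma line_point_thin v : line_point v -> thin v.
Proof.
move=> [x [vx _]] n a b [av an] [bv bn].
have [y ya] := path_extends a; have [z zb] := path_extends b.
have init_v (w : infpath L) (c : mor L) :
    w (omega_init (deg c)) = c -> rng c = v -> w = x.
  move=> wc cv; have : infpaths_from v w.
    by rewrite /infpaths_from/= -(init_rng w (deg c)) wc.
  by rewrite vx.
move: (init_v _ _ ya av) (init_v _ _ zb bv) => yx zx; subst y z.
by rewrite -ya -zb an bn.
Qed.

Lemma thin_line_point v : thin v ->
  (forall x, path_vertex x 0 = v -> aperiodic_path x) -> line_point v.
Proof.
move=> tv ap; have [x xv] := path_extends (idm L v).
have x0 : path_vertex x 0 = v.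
  by rewrite -(init_rng x (deg (idm L v))) xv rng_id.
exists x; split; last exact: ap.
apply/seteqP; split => [y yv|y ->//].
exact: (thin_infpath_uniq (v := v)).
Qed.

End InfinitePathTheory.

(** * An invariant of the talented monoid *)

Section Weight.
Variables (k : nat) (L : kgraph k).
Hypotheses (hfin : row_finite L) (hsrc : no_sources L).
Variable v : vert L.
Implicit Types (w : vert L) (n : intvec k).

(** [w] is thin, and the paths out of [v] and [w] reach a common vertex at
    degrees that become equal once [w] is placed at [n]. *)
Definition merges w n := thin w /\ exists p q a b,
  [/\ paths_from v p a, paths_from w q b, src a = src b &
      int_of_natvec p = n + int_of_natvec q].

(** [merges] is invariant under following the only edge of a given colour. *)
Lemma merges_step w n i a : paths_from w (evec i) = [set a] ->
  merges w n <-> merges (src a) (n + int_of_natvec (evec i)).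
Proof.
move=> wa; have aw : paths_from w (evec i) a by rewrite wa.
split=> [[tw [p [q [b [c [vb wc bc pq]]]]]]|].
  split; first exact: thin_src tw aw.
  have [d dP] := hsrc (src b) (evec i).
  have dP' : paths_from (src c) (evec i) d by rewrite -bc.
  have := paths_from_comp wc dP'; rewrite addrC.
  move=> /paths_from_factor[a' [g [+ ag E]]]; rewrite wa /= => aa'; subst a'.
  exists (p + evec i), q, (Defs.comp b d), g; split => //.
  - exact: paths_from_comp.
  - rewrite src_comp ?dP.1// -[RHS](@src_comp k L a g) ?ag.1// -E.
    by rewrite src_comp ?dP'.1.
  - by rewrite int_of_natvecD pq addrAC.
move=> [ta [p [q [b [c [vb ac bc pq]]]]]].
split; first exact: thin_single wa ta.
exists p, (evec i + q), b, (Defs.comp a c); split => //.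
- exact: paths_from_comp.
- by rewrite src_comp// ac.1.
- by rewrite int_of_natvecD pq addrA.
Qed.

(** Weight 2 stands for at least 2: only weights truncated at 2 are
    invariants of the talented monoid. *)
Definition gen_weight (g : tgen L) : nat :=
  if `[< merges g.1 g.2 >] then 1 else 2.

(** The additive extension of [gen_weight] to the free commutative monoid. *)
Definition weight (x : {mset tgen L}) : nat := \sum_(g <- x) gen_weight g.

Lemma gen_weight_gt0 g : (0 < gen_weight g)%N.
Proof. by rewrite /gen_weight; case: ifP. Qed.

Lemma weight0 : weight 0 = 0%N.
Proof. by rewrite /weight big_mset0. Qed.

Lemma weightD x y : weight (x + y) = (weight x + weight y)%N.
Proof. exact: big_msetD. Qed.

Lemma weight1 g : weight [mset g] = gen_weight g.
Proof. by rewrite /weight enum_msetn /= big_seq1. Qed.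

Lemma weight_eq0 x : weight x = 0%N -> x = 0.
Proof.
move=> x0; rewrite [x]mset_sum1; move: x0; rewrite /weight.
case: (x : seq _) => [|g s]; first by rewrite !big_nil.
by rewrite big_cons => /eqP; rewrite addn_eq0 eqn0Ngt gen_weight_gt0.
Qed.

Lemma weight_rel x y : talented_rel x y ->
  minn 2 (weight x) = minn 2 (weight y).
Proof.
move=> [w n i wi]; have fA := hfin w (evec i).
rewrite weight1 fsbig_finite// (big_morph _ weightD weight0).
rewrite -fsbig_finite//=; under eq_fsbigr do rewrite weight1.
have [a wa] := wi.
(* With two edges both sides are truncated to 2; with a single one the
   weight of the source is that of [w], by [merges_step]. *)
have [[b wb ba]|single] :=
    pselect (exists2 b, paths_from w (evec i) b & b <> a).
  rewrite (fsbigD1 a)//= (fsbigD1 b)//=; last exact: finite_setD.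
  rewrite /gen_weight/= ifF; last first.
    by apply/asboolP => -[tw _]; apply: ba; apply: tw wb wa.
  have trunc2 s t r : (0 < s)%N -> (0 < t)%N ->
      minn 2 2 = minn 2 (s + (t + r))%N.
    lia.
  by apply: trunc2; apply: (gen_weight_gt0 (src _, _)).
have {wa}wa : paths_from w (evec i) = [set a].
  apply/seteqP; split => [b wb|b ->//]; apply: contrapT => ba.
  by apply: single; exists b.
rewrite wa fsbig_set1 /gen_weight/=; congr (minn 2 (if _ then _ else _)).
by apply: asbool_equiv_eq; apply: merges_step.
Qed.

Lemma weight_mcong x y : mcong (@talented_rel k L) x y ->
  minn 2 (weight x) = minn 2 (weight y).
Proof.
have trunc s t : minn 2 (s + t)%N = minn 2 (minn 2 s + minn 2 t)%N by lia.
elim=> {x y} [x y|x|x y _|x y z _ -> _|x y z t _ xy _ zt] //.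
  exact: weight_rel.
by rewrite !weightD trunc xy zt -trunc.
Qed.

End Weight.

(** * Vertices as elements of the talented monoid *)

Section VertexElements.
Variables (k : nat) (L : kgraph k).
Hypotheses (hfin : row_finite L) (hsrc : no_sources L).
Implicit Types (v w : vert L) (n : intvec k).

Lemma mon_unitDl (M : nmodType) (x y : M) : mon_unit (x + y) -> mon_unit x.
Proof. by move=> [z E]; exists (y + z); rewrite addrA. Qed.

Lemma tvert_nonunit w n : ~ mon_unit (tvert w n).
Proof.
move=> [z]; rewrite -(class_of_repr z) /tvert /gen -class_ofD -class_of0.
move=> /class_ofP /(weight_mcong hfin hsrc w).
rewrite weight0 weightD weight1; have := gen_weight_gt0 w (w, n); lia.
Qed.

Lemma tvert_neq0 w n : tvert w n <> 0.
Proof. by move=> E; apply: (@tvert_nonunit w n); exists 0; rewrite E addr0. Qed.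

Lemma thin_atom v : thin v -> atom (tvert v 0).
Proof.
move=> tv; split; first exact: tvert_nonunit.
move=> b c; rewrite -(class_of_repr b) -(class_of_repr c) -class_ofD.
move=> /class_ofP /(weight_mcong hfin hsrc v).
rewrite weight1 weightD /gen_weight asboolT; last first.
  split=> //; exists 0, 0, (idm L v), (idm L v).
  by split; rewrite ?add0r//; split; rewrite ?rng_id ?deg_id.
set s := weight v (repr b); set t := weight v (repr c) => st.
have [s0|t0] : s = 0%N \/ t = 0%N by lia.
- by left; rewrite (weight_eq0 s0); exists 0; rewrite addr0.
- by right; rewrite (weight_eq0 t0); exists 0; rewrite addr0.
Qed.

Lemma line_point_aperiodic v : line_point v -> ~ periodic (tvert v 0).
Proof.
move=> lv; have tv := line_point_thin hsrc lv.
move=> [_ [n [n0]]]; rewrite tact_vert add0r.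
move=> /class_ofP /(weight_mcong hfin hsrc v).
rewrite !weight1 /gen_weight /= [X in _ = minn 2 (if X then _ else _)]asboolT.
  case: asboolP => // -[_ [p [q [a [b [va vb ab pq]]]]]] _.
  have [x [vx ax]] := lv.
  have x0 : path_vertex x 0 = v by have : infpaths_from v x by rewrite vx.
  have xa := thin_init tv x0 va.
  have xb := thin_init tv x0 vb.
  have E : shift p x = shift q x.
    apply: (thin_infpath_uniq (v := src a)); first exact: thin_src tv va.
      by rewrite shift_vertex0 -init_src xa.
    by rewrite shift_vertex0 -init_src xb.
  move: pq; rewrite (ax _ _ E) => /eqP.
  by rewrite eq_sym -subr_eq0 addrK => /eqP.
split=> //; exists 0, 0, (idm L v), (idm L v).
by split; rewrite ?add0r//; split; rewrite ?rng_id ?deg_id.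
Qed.

Lemma atom_edge_uniq w n i a b : atom (tvert w n) ->
  paths_from w (evec i) a -> paths_from w (evec i) b -> a = b.
Proof.
move=> [_ at_w] wa wb; have fA := hfin w (evec i).
apply: contrapT => ab.
have := tvert_rel n fA (ex_intro _ a wa).
rewrite (fsbigD1 a)//= (fsbigD1 b)//=; last 2 first.
- exact: finite_setD.
- by split => // ba; apply: ab.
move=> /at_w[/tvert_nonunit//|/mon_unitDl/tvert_nonunit//].
Qed.

(** An atomic vertex has at most one path of each degree, and the ends of such
    a path give the same element. *)
Lemma atom_path p w n a b : atom (tvert w n) ->
  paths_from w p a -> paths_from w p b ->
  a = b /\ tvert w n = tvert (src a) (n + int_of_natvec p).
Proof.
elim/natvec_ind: p w n a b => [|i p IHp] w n a b at_w.
  move=> [aw a0] [bw b0]; split.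
    by rewrite (deg0_id a0) (deg0_id b0) aw bw.
  rewrite deg0_src// aw; congr tvert.
  by apply/ffunP => j; rewrite !ffunE addr0.
move=> /paths_from_factor[a1 [a2 [wa1 a12 ->]]].
move=> /paths_from_factor[b1 [b2 [wb1 b12 ->]]].
have E1 := atom_edge_uniq at_w wa1 wb1; subst b1.
have wE : paths_from w (evec i) = [set a1].
  apply/seteqP; split => [c wc|c ->//].
  exact: atom_edge_uniq at_w wc wa1.
have Ew : tvert w n = tvert (src a1) (n + int_of_natvec (evec i)).
  have := tvert_rel n (hfin w (evec i)) (ex_intro _ a1 wa1).
  by rewrite {1}wE fsbig_set1.
rewrite Ew in at_w.
have [<- E] := IHp _ _ _ _ at_w a12 b12.
by split; rewrite // src_comp ?a12.1// Ew E int_of_natvecD addrA.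
Qed.

Lemma atom_thin v n : atom (tvert v n) -> thin v.
Proof. by move=> at_v p a b va vb; have [] := atom_path at_v va vb. Qed.

Lemma atom_path_vertex (x : infpath L) p : atom (tvert (path_vertex x 0) 0) ->
  tvert (path_vertex x 0) 0 = tvert (path_vertex x p) (int_of_natvec p).
Proof.
move=> at_v; have xp := init_paths_from x p.
by have [_ ->] := atom_path at_v xp xp; rewrite init_src add0r.
Qed.

Lemma atom_aperiodic_path (x : infpath L) : atom (tvert (path_vertex x 0) 0) ->
  ~ periodic (tvert (path_vertex x 0) 0) -> aperiodic_path x.
Proof.
move=> at_v np m n mn; apply: contrapT => mn0; apply: np; split.
  exact: tvert_neq0.
exists (int_of_natvec m - int_of_natvec n); split.
  by move=> /eqP; rewrite subr_eq0 => /eqP /int_of_natvec_inj.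
have xmn : path_vertex x n = path_vertex x m.
  by rewrite -(shift_vertex0 x n) -mn shift_vertex0.
have Em := atom_path_vertex m at_v; have En := atom_path_vertex n at_v.
(* [v(0) = x(n)(n)] is moved by [m - n] to [x(n)(m) = x(m)(m) = v(0)]. *)
by rewrite [X in tact _ X]En tact_vert addrC subrK xmn; apply: esym.
Qed.

End VertexElements.

Theorem theorem5p6 (k : nat) (hk : (0 < k)%N) (L : kgraph k)
    (hfin : row_finite L) (hsrc : no_sources L) (v : vert L) :
  line_point v <-> (atom (tvert v 0) /\ aperiodic (tvert v 0)).
Proof.
split=> [lv|[at_v [_ np]]].
  split; first exact/thin_atom/line_point_thin.
  by split; [apply: tvert_neq0 | apply: line_point_aperiodic].
apply: thin_line_point => //; first exact: (atom_thin hfin hsrc (n := 0)).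
by move=> x xv; apply: atom_aperiodic_path; rewrite // xv.
Qed.
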